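(* For every $f\in \mathrm{End}(\mathbb N)$, $$f\star\, !(f) \;=\; !(f).$$
   Context: $\mathbb N=\{0,1,2,\dots\}$. $\mathbf{pInj}$ is the category of sets and partial injections (partial functions that are injective on their domain of definition), with the usual relational composition, $gf$ meaning ''first $f$, then $g$''. $\mathrm{End}(\mathbb N)=\mathbf{pInj}(\mathbb N,\mathbb N)$ is the monoid of partial injections $\mathbb N\to\mathbb N$, with identity $1_{\mathbb N}$. Disjoint union: $\mathbb N\uplus\mathbb N=\mathbb N\times\{0,1\}$, and for $f,g\in\mathrm{End}(\mathbb N)$, $f\uplus g$ is the partial injection $(n,0)\mapsto (f(n),0)$, $(n,1)\mapsto (g(n),1)$ (undefined where $f(n)$, respectively $g(n)$, is undefined). The Cantor pairing is the bijection $c:\mathbb N\uplus\mathbb N\to\mathbb N$, $c(n,i)=2n+i$, with inverse $d=c^{-1}$. The untyped tensor is $f\star g = c\,(f\uplus g)\,d$. For $f,g\in\mathrm{End}(\mathbb N)$, $f\times g$ is the partial injection $(x,y)\mapsto (f(x),g(y))$ on $\mathbb N\times\mathbb N$, defined exactly when both $f(x)$ and $g(y)$ are defined. The exponential bijection is $\psi:\mathbb N\times\mathbb N\to\mathbb N$, $\psi(x,y)=2^{y+1}x+2^y-1$. The exponential tensor is $f\odot g=\psi\,(f\times g)\,\psi^{-1}$. The bang operation $!(\ ):\mathrm{End}(\mathbb N)\to\mathrm{End}(\mathbb N)$ is $!(f)=f\odot 1_{\mathbb N}$. *)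

(* Defs.v *)
From mathcomp Require Import all_boot.

Set Implicit Arguments.
Unset Strict Implicit.
Unset Printing Implicit Defensive.

(* Morphisms of pInj.  They are represented by their graphs, as Prop-valued
   relations, so that domains of definition need not be decidable. *)
Record pinj (A B : Type) := PInj {
  pinj_rel :> A -> B -> Prop;
  pinj_functional : forall x y y', pinj_rel x y -> pinj_rel x y' -> y = y';
  pinj_injective : forall x x' y, pinj_rel x y -> pinj_rel x' y -> x = x'
}.

Definition End (A : Type) := pinj A A.

Lemma pid_functional A (x y y' : A) : x = y -> x = y' -> y = y'.
Proof. by move=> <-. Qed.

Lemma pid_injective A (x x' y : A) : x = y -> x' = y -> x = x'.
Proof. by move=> -> ->. Qed.

Definition pid (A : Type) : End A :=
  PInj (@pid_functional A) (@pid_injective A).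

Section Comp.
Variables (A B C : Type) (g : pinj B C) (f : pinj A B).

Definition pinj_comp_rel (x : A) (z : C) := exists2 y, f x y & g y z.

Lemma pinj_comp_functional x z z' : pinj_comp_rel x z -> pinj_comp_rel x z' -> z = z'.
Proof.
move=> [y fxy gyz] [y' fxy' gyz']; apply: pinj_functional gyz _.
by rewrite (pinj_functional fxy fxy').
Qed.

Lemma pinj_comp_injective x x' z : pinj_comp_rel x z -> pinj_comp_rel x' z -> x = x'.
Proof.
move=> [y fxy gyz] [y' fxy' gyz']; apply: pinj_injective fxy _.
by rewrite (pinj_injective gyz gyz').
Qed.

(* First f, then g. *)
Definition pinj_comp : pinj A C := PInj pinj_comp_functional pinj_comp_injective.
End Comp.

(* The converse relation; the inverse of f when f is a bijection. *)
Definition pinv (A B : Type) (f : pinj A B) : pinj B A :=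
  @PInj B A (fun y x => f x y)
    (fun y x x' => @pinj_injective A B f x x' y)
    (fun y y' x => @pinj_functional A B f x y y').

Section Graph.
Variables (A B : Type) (h : A -> B) (h_bij : bijective h).

Lemma graph_functional x y y' : h x = y -> h x = y' -> y = y'.
Proof. by move=> <-. Qed.

Lemma graph_injective x x' y : h x = y -> h x' = y -> x = x'.
Proof. by move=> <- /(bij_inj h_bij). Qed.

Definition pbij : pinj A B := PInj graph_functional graph_injective.

Lemma pbijK x x' : pinj_comp (pinv pbij) pbij x x' <-> pid A x x'.
Proof.
split=> [[y <- /(bij_inj h_bij)] // | <-]; by exists (h x).
Qed.

Lemma pinvK y y' : pinj_comp pbij (pinv pbij) y y' <-> pid B y y'.
Proof.
split=> [[x <- <-] // | <-]; case: h_bij => k _ kK; by exists (k y) => /=.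
Qed.
End Graph.

Section DisjointUnion.
Variables (A B : Type) (f g : pinj A B).

(* The index set {0, 1} is bool, with 0 = false and 1 = true. *)
Definition psum_rel (p : A * bool) (q : B * bool) :=
  p.2 = q.2 /\ (if p.2 then g p.1 q.1 else f p.1 q.1).

Lemma psum_functional p q q' : psum_rel p q -> psum_rel p q' -> q = q'.
Proof.
case: p q q' => [x i] [y j] [y' j'] [/= <- fxy] [/= <- fxy'].
by case: i fxy fxy' => fxy fxy'; rewrite (pinj_functional fxy fxy').
Qed.

Lemma psum_injective p p' q : psum_rel p q -> psum_rel p' q -> p = p'.
Proof.
case: p p' q => [x i] [x' i'] [y j] [/= -> fxy] [/= -> fxy'].
by case: j fxy fxy' => fxy fxy'; rewrite (pinj_injective fxy fxy').
Qed.

Definition psum : pinj (A * bool) (B * bool) :=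
  PInj psum_functional psum_injective.
End DisjointUnion.

Section Product.
Variables (A B C D : Type) (f : pinj A B) (g : pinj C D).

Definition pprod_rel (p : A * C) (q : B * D) := f p.1 q.1 /\ g p.2 q.2.

Lemma pprod_functional p q q' : pprod_rel p q -> pprod_rel p q' -> q = q'.
Proof.
case: p q q' => [x i] [y j] [y' j'] [/= fxy gij] [/= fxy' gij'].
by rewrite (pinj_functional fxy fxy') (pinj_functional gij gij').
Qed.

Lemma pprod_injective p p' q : pprod_rel p q -> pprod_rel p' q -> p = p'.
Proof.
case: p p' q => [x i] [x' i'] [y j] [/= fxy gij] [/= fxy' gij'].
by rewrite (pinj_injective fxy fxy') (pinj_injective gij gij').
Qed.

Definition pprod : pinj (A * C) (B * D) :=
  PInj pprod_functional pprod_injective.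
End Product.

Definition cantor (p : nat * bool) : nat := 2 * p.1 + p.2.

Lemma cantor_bij : bijective cantor.
Proof.
exists (fun n => (n./2, odd n)) => [[n i] | n]; rewrite /cantor /= mul2n.
  by rewrite addnC half_bit_double oddD odd_double oddb addbF.
by rewrite addnC odd_double_half.
Qed.

(* The subtraction never truncates, since 0 < 2 ^ y. *)
Definition psi (p : nat * nat) : nat := 2 ^ p.2.+1 * p.1 + 2 ^ p.2 - 1.

Lemma psi_bij : bijective psi.
Proof.
have psiS x y : (psi (x, y)).+1 = 2 ^ y * x.*2.+1.
  rewrite /psi /= -addnBA ?expn_gt0 // -addnS -subSn ?expn_gt0 // subn1 /=.
  by rewrite expnS -mul2n mulnS mulnA (mulnC 2 (2 ^ y)) addnC.
exists (fun n => ((n.+1 %/ 2 ^ logn 2 n.+1)./2, logn 2 n.+1)) => [[x y] | n].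
  have Ly : logn 2 (2 ^ y * x.*2.+1) = y.
    rewrite lognM ?expn_gt0 // lognX (logn_prime 2 (isT : prime 2)) /= muln1.
    by rewrite logn_coprime ?addn0 // coprime2n /= odd_double.
  by rewrite psiS Ly mulKn ?expn_gt0 //= uphalf_double.
apply: succn_inj; rewrite psiS.
have [m m_odd En] := pfactor_coprime (isT : prime 2) (ltn0Sn n).
rewrite {1 2}En mulnK ?expn_gt0 // mulnC [RHS]En.
congr (_ * _); last by rewrite -En.
by rewrite coprime2n in m_odd; rewrite -[RHS]odd_double_half m_odd.
Qed.

Definition c : pinj (nat * bool) nat := pbij cantor_bij.
Definition d : pinj nat (nat * bool) := pinv c.

Definition psi_pinj : pinj (nat * nat) nat := pbij psi_bij.

(* The untyped tensor. *)
Definition star (f g : End nat) : End nat := pinj_comp c (pinj_comp (psum f g) d).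

(* The exponential tensor. *)
Definition odot (f g : End nat) : End nat :=
  pinj_comp psi_pinj (pinj_comp (pprod f g) (pinv psi_pinj)).

Definition bang (f : End nat) : End nat := odot f (pid nat).

(* Main.v *)
Require Import Defs.
From mathcomp Require Import all_boot.
From Stdlib Require Import FunctionalExtensionality PropExtensionality.
From Stdlib Require Import ProofIrrelevance.

(** The map [psi] enumerates the disjoint union of countably many copies of
    [nat] by iterating the Cantor pairing [cantor]: the copy of index 0 is the
    even numbers, and the copy of index [k.+1] is the copy of index [k] pushed
    into the odd numbers ([psi_0] and [psi_S]).  In these coordinates [bang f]
    applies [f] inside every copy and preserves the index ([bang_psi]), while
    [star f (bang f)] applies [f] on the even numbers and [bang f] on the odd
    ones ([star_cantor]).  The even numbers are copy 0 and the odd numbers are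
    the remaining copies shifted by one, so the two partial injections agree at
    every pair of codes; as [psi] is onto, they are equal. *)

Set Implicit Arguments.
Unset Strict Implicit.
Unset Printing Implicit Defensive.

(** Extensionality of the relations is not enough by itself: the records also
    carry proofs of functionality and injectivity, hence the appeal to proof
    irrelevance. *)
Lemma pinj_ext (A B : Type) (f g : pinj A B) :
  (forall x y, f x y <-> g x y) -> f = g.
Proof.
case: f g => [r fr ir] [s fs is_] /= rs.
have ers : r = s.
  do 2!apply: functional_extensionality => ?.
  exact: propositional_extensionality.
by case: _ / ers fs is_ {rs} => fs is_; congr PInj; apply: proof_irrelevance.
Qed.

(** Both tensors are conjugates by a coding bijection; this reads a conjugate
    back on codes. *)
Lemma conj_pbijE (A B : Type) (h : A -> B) (h_bij : bijective h)
    (r : pinj A A) (p q : A) :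
  pinj_comp (pbij h_bij) (pinj_comp r (pinv (pbij h_bij))) (h p) (h q)
    <-> r p q.
Proof.
have h_inj := bij_inj h_bij.
split=> [[q' [p' /h_inj -> rpq] /h_inj <-] //|rpq].
by exists q => //; exists p.
Qed.

Lemma star_cantor (f g : End nat) (p q : nat * bool) :
  star f g (cantor p) (cantor q) <-> psum f g p q.
Proof. exact: conj_pbijE. Qed.

Lemma bang_psi (f : End nat) (x k y l : nat) :
  bang f (psi (x, k)) (psi (y, l)) <-> f x y /\ k = l.
Proof. exact: conj_pbijE. Qed.

Lemma psi_0 x : psi (x, 0) = cantor (x, false).
Proof. by rewrite /psi /cantor /= addn0 addnK. Qed.

Lemma psi_S x k : psi (x, k.+1) = cantor (psi (x, k), true).
Proof.
rewrite /psi /cantor /= !(expnS 2 k.+1) (expnS 2 k) mulnBr mulnDr !mulnA.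
(* The sides are now a - 1 and (a - 2 * 1) + 1 with 2 <= a, so that neither
   subtraction truncates. *)
by rewrite addn1 -subSn ?subSS // ltn_addl // leq_pmulr ?expn_gt0.
Qed.

Theorem corollary4p11 (f : End nat) : star f (bang f) = bang f.
Proof.
apply: pinj_ext => m n.
have [psi' _ psiK] := psi_bij.
rewrite -(psiK m) -(psiK n).
case: (psi' m) (psi' n) => [x k] [y l].
rewrite bang_psi; case: k l => [|k] [|l]; rewrite ?psi_0 ?psi_S star_cantor.
- by split=> [[]|[]].
- by split=> [[]|[]].
- by split=> [[]|[]].
split=> [[_ /bang_psi[fxy ->]] //|[fxy [->]]].
by split=> //; apply/bang_psi.
Qed.
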